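(* Let $A\in\mathbb{R}^{n\times n}$, $B\in\mathbb{R}^{n\times m}$ and $x_0\in\mathbb{R}^n$. The Fast exploration algorithm, applied to the system $x_{k+1}=Ax_k+Bu_k$ with initial condition $x_0$, terminates after at most $n+m$ time steps. In addition, if there exist $N'\in\mathbb{N}$ and an input sequence $(u'_k)_{k=0}^{N'-1}\subseteq\mathbb{R}^m$ such that $(A,B)$ is uniquely determined by the resulting data set $\{(x'_{k+1},x'_k,u'_k)\mid k=0,\dots,N'-1\}$, where $x'_0=x_0$ and $x'_{k+1}=Ax'_k+Bu'_k$, then $(A,B)$ is also uniquely determined by the data set $\mathcal{D}_N$ returned by the Fast exploration algorithm, and $(A,B)=(\hat A_0(\mathcal{D}_N),\hat B_0(\mathcal{D}_N))$.
   Context: System: $x_{k+1}=Ax_k+Bu_k$, discrete time, with state $x_k\in\mathbb{R}^n$, input $u_k\in\mathbb{R}^m$, $A\in\mathbb{R}^{n\times n}$, $B\in\mathbb{R}^{n\times m}$; $e_1,\dots,e_m$ are the standard unit vectors of $\mathbb{R}^m$. Fast exploration algorithm. Given the initial state $x_0$, put $x_{-1}:=0$, $s:=1$, $k:=0$, $\mathcal{D}_0:=\emptyset$. Repeat: set $u_k:=0$. If $x_k\in\operatorname{span}\{x_{k-1},\dots,x_0,x_{-1}\}$, then: if $s>m$, stop and return $\mathcal{D}_k$; otherwise set $u_k:=e_s$ and increase $s$ by one. Then (if not stopped) let $x_{k+1}:=Ax_k+Bu_k$, $\mathcal{D}_{k+1}:=\mathcal{D}_k\cup\{(x_{k+1},x_k,u_k)\}$,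 and increase $k$ by one. $N$ denotes the value of $k$ at which the algorithm stops, i.e. the number of time steps (system interactions) performed. Data consistency. For a data set $\mathcal{D}=\{(x_k^+,x_k,u_k)\mid k=0,\dots,N-1\}$, let $\mathcal{H}(\mathcal{D})$ be the set of all $(\hat A,\hat B)\in\mathbb{R}^{n\times n}\times\mathbb{R}^{n\times m}$ with $x_k^+=\hat Ax_k+\hat Bu_k$ for $k=0,\dots,N-1$. The data set $\mathcal{D}$ uniquely determines $(A,B)$ if $\mathcal{H}(\mathcal{D})=\{(A,B)\}$. Pseudo estimator. For a data set $\mathcal{D}$ with $\mathcal{H}(\mathcal{D})\ne\emptyset$, $(\hat A_0(\mathcal{D}),\hat B_0(\mathcal{D}))$ is the unique minimizer of $\|\hat A\|_F^2+\|\hat B\|_F^2$ (Frobenius norms) over $(\hat A,\hat B)\in\mathcal{H}(\mathcal{D})$. Equivalently, $\begin{pmatrix}\hat A_0(\mathcal{D})&\hat B_0(\mathcal{D})\end{pmatrix}=X^+\begin{pmatrix}X \\ U\end{pmatrix}^{\dagger}$, where $X=(x_0\ \cdots\ x_{N-1})$, $X^+=(x_0^+\ \cdots\ x_{N-1}^+)$, $U=(u_0\ \cdots\ u_{N-1})$ and $(\cdot)^\dagger$ is the Moore–Penrose pseudoinverse. *)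

(* Defs.v *)
From mathcomp Require Import all_boot all_order all_algebra.
From mathcomp Require Import boolp classical_sets reals.
Set Implicit Arguments.
Unset Strict Implicit.
Unset Printing Implicit Defensive.
Import Order.TTheory GRing.Theory Num.Theory.
Local Open Scope classical_set_scope.
Local Open Scope ring_scope.

(* A triple (x_plus, x, u) records one interaction x_plus = A x + B u. *)
Definition dataset (R : realType) (n m : nat) :=
  set ('cV[R]_n * 'cV[R]_n * 'cV[R]_m).

Definition sys_next (R : realType) (n m : nat) (A : 'M[R]_n) (B : 'M[R]_(n, m))
    (x : 'cV[R]_n) (u : 'cV[R]_m) : 'cV[R]_n := A *m x + B *m u.

Fixpoint trajectory (R : realType) (n m : nat) (A : 'M[R]_n)
    (B : 'M[R]_(n, m)) (x0 : 'cV[R]_n) (u : nat -> 'cV[R]_m) (k : nat) :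
    'cV[R]_n :=
  if k is k'.+1 then sys_next A B (trajectory A B x0 u k') (u k') else x0.

(* Only the inputs u 0, ..., u (N - 1) occur. *)
Definition trajectory_data (R : realType) (n m : nat) (A : 'M[R]_n)
    (B : 'M[R]_(n, m)) (x0 : 'cV[R]_n) (u : nat -> 'cV[R]_m) (N : nat) :
    dataset R n m :=
  [set d | exists2 k, (k < N)%N &
    d = (trajectory A B x0 u k.+1, trajectory A B x0 u k, u k)].

Definition consistent (R : realType) (n m : nat) (D : dataset R n m) :
    set ('M[R]_n * 'M[R]_(n, m)) :=
  [set AB | forall xp x u, D (xp, x, u) -> xp = AB.1 *m x + AB.2 *m u].

Definition uniquely_determines (R : realType) (n m : nat) (D : dataset R n m)
    (A : 'M[R]_n) (B : 'M[R]_(n, m)) : Prop :=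
  consistent D = [set (A, B)].

Definition frobenius_norm (R : realType) (p q : nat) (M : 'M[R]_(p, q)) : R :=
  Num.sqrt (\sum_i \sum_j M i j ^+ 2).

Definition estimator_cost (R : realType) (n m : nat)
    (AB : 'M[R]_n * 'M[R]_(n, m)) : R :=
  frobenius_norm AB.1 ^+ 2 + frobenius_norm AB.2 ^+ 2.

Definition unique_minimizer (R : realType) (n m : nat) (D : dataset R n m)
    (AB : 'M[R]_n * 'M[R]_(n, m)) : Prop :=
  consistent D AB /\
  forall AB', consistent D AB' -> AB' <> AB ->
    estimator_cost AB < estimator_cost AB'.

(* The default value (0, 0) is used only when [consistent D] is empty. *)
Definition pseudo_estimator (R : realType) (n m : nat) (D : dataset R n m) :
    'M[R]_n * 'M[R]_(n, m) :=
  xget (0, 0) [set AB | unique_minimizer D AB].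

(* Unit vectors are numbered from 1: [unit_vec R m s] is e_s for 1 <= s <= m. *)
Definition unit_vec (R : realType) (m s : nat) : 'cV[R]_m :=
  \col_(i < m) (i.+1 == s)%:R.

(* State of the algorithm at the top of the loop, when the counter is k. *)
Record fe_state (R : realType) (n m : nat) := FEState {
  fe_time : nat;                  (* k *)
  fe_cur  : 'cV[R]_n;             (* x_k *)
  fe_past : seq 'cV[R]_n;         (* [:: x_{k-1}; ...; x_0; x_{-1}] *)
  fe_idx  : nat;                  (* s *)
  fe_data : dataset R n m         (* D_k *)
}.

Definition fe_init (R : realType) (n m : nat) (x0 : 'cV[R]_n) :
    fe_state R n m :=
  FEState 0 x0 [:: 0] 1 set0.

Definition fe_apply (R : realType) (n m : nat) (A : 'M[R]_n)
    (B : 'M[R]_(n, m)) (st : fe_state R n m) (u : 'cV[R]_m) (s : nat) :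
    fe_state R n m :=
  let x := fe_cur st in
  let xp := sys_next A B x u in
  FEState (fe_time st).+1 xp (x :: fe_past st) s
          (fe_data st `|` [set (xp, x, u)]).

(* One pass through the loop; [None] means that the algorithm stops. *)
Definition fe_step (R : realType) (n m : nat) (A : 'M[R]_n)
    (B : 'M[R]_(n, m)) (st : fe_state R n m) : option (fe_state R n m) :=
  if fe_cur st \in <<fe_past st>>%VS then
    if (m < fe_idx st)%N then None
    else Some (fe_apply A B st (unit_vec R m (fe_idx st)) (fe_idx st).+1)
  else Some (fe_apply A B st 0 (fe_idx st)).

(* [fe_exec A B st N D]: started in [st], the loop stops, with counter N and
   returned data set D; no such N and D exist when the loop runs forever. *)
Inductive fe_exec (R : realType) (n m : nat) (A : 'M[R]_n) (B : 'M[R]_(n, m)) :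
    fe_state R n m -> nat -> dataset R n m -> Prop :=
| FEStop st : fe_step A B st = None ->
    fe_exec A B st (fe_time st) (fe_data st)
| FENext st st' N D : fe_step A B st = Some st' ->
    fe_exec A B st' N D -> fe_exec A B st N D.

Definition fast_exploration (R : realType) (n m : nat) (A : 'M[R]_n)
    (B : 'M[R]_(n, m)) (x0 : 'cV[R]_n) (N : nat) (D : dataset R n m) : Prop :=
  fe_exec A B (fe_init m x0) N D.

Lemma fast_exploration_functional (R : realType) (n m : nat) (A : 'M[R]_n)
    (B : 'M[R]_(n, m)) (x0 : 'cV[R]_n) (N1 N2 : nat) (D1 D2 : dataset R n m) :
  fast_exploration A B x0 N1 D1 -> fast_exploration A B x0 N2 D2 ->
  N1 = N2 /\ D1 = D2.
Proof.
rewrite /fast_exploration => e1; elim: e1 N2 D2 => {N1 D1}.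
  move=> st stop N2 D2 e2; inversion e2 as [st0 _ |st0 st1 N D step _]; subst => //.
  by rewrite stop in step.
move=> st st' N D step _ IH N2 D2 e2.
inversion e2 as [st0 stop|st0 st1 N' D' step' e']; subst.
  by rewrite stop in step.
by apply: IH; move: step'; rewrite step => -[->].
Qed.

(* Main.v *)
Require Import Defs.
From mathcomp Require Import all_boot all_order all_algebra.
From mathcomp Require Import boolp classical_sets reals.
Local Open Scope ring_scope.
Import GRing.Theory.

(** Write V for the span of the visited states.  Every pass through the loop
    either enlarges V by one dimension or uses up one unit vector, so that
    k = dim V + (s - 1); since dim V <= n and s - 1 <= m, the loop stops with
    k <= n + m.

    The data loses nothing, because the pairs (x_k, u_k) span the whole product
    of V with span {e_1, ..., e_(s-1)}: a state outside the old span is paired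
    with the input 0, while a state x_k inside it has (x_k, 0) already in the
    span of the earlier pairs, so that (x_k, e_s) contributes (0, e_s).  Hence
    any pair (A', B') consistent with the data agrees with A on V and with B on
    the inputs used.  In the same way A maps V, and B maps the inputs used, into
    the span of V and the current state; at the stopping time that state is in
    V and all inputs have been used, so V contains x_0, is invariant under A and
    contains the range of B.

    Consequently every trajectory from x_0 stays in V, where a pair consistent
    with the data of the algorithm cannot be told from (A, B).  Such a pair thus
    explains the data of every experiment started in x_0, and if some experiment
    determines (A, B), it equals (A, B).  The only consistent pair is
    then trivially the one of least Frobenius norm.

    The lemma [fe_step_invariant] carries these facts through one pass of the
    loop, [fe_terminates] iterates it, and [fe_final_explains_all] is the
    comparison with another experiment. *)

(** * Spans *)

Lemma mem_span_cons {K : fieldType} {V : vectType K} {x v : V} {X : seq V} :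
  v \in <<x :: X>>%VS -> exists c w, w \in <<X>>%VS /\ v = c *: x + w.
Proof.
rewrite span_cons => /memv_addP [y /vlineP [c ->] [w wX ->]].
by exists c, w.
Qed.

Lemma span_cons_mem {K : fieldType} {V : vectType K} {x : V} {X : seq V} :
  x \in <<X>>%VS -> <<x :: X>>%VS = <<X>>%VS.
Proof. by rewrite span_cons => xX; apply/addv_idPr; rewrite -memvE. Qed.

Lemma span_cons_sub {K : fieldType} {V : vectType K} (x : V) {X : seq V} {v : V} :
  v \in <<X>>%VS -> v \in <<x :: X>>%VS.
Proof. by rewrite span_cons; apply: (subvP (addvSr _ _)). Qed.

Lemma head_mem_span {K : fieldType} {V : vectType K} (x : V) (X : seq V) :
  x \in <<x :: X>>%VS.
Proof. by apply: memv_span; rewrite mem_head. Qed.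

Lemma dim_span_cons_notin {K : fieldType} {V : vectType K} {x : V} {X : seq V} :
  x \notin <<X>>%VS -> \dim <<x :: X>> = (\dim <<X>>).+1.
Proof.
move=> xX; have x0 : x != 0 by apply: contraNneq xX => ->; apply: mem0v.
rewrite span_cons dimv_disjoint_sum ?dim_vline ?x0 ?add1n //.
apply/eqP; rewrite -subv0; apply/subvP => v /memv_capP [/vlineP [c ->]] cxX.
have [->|c0] := eqVneq c 0; first by rewrite scale0r mem0v.
by rewrite -(scalerK c0 x) memvZ in xX.
Qed.

Lemma dim_span_col {R : realType} {n : nat} (X : seq 'cV[R]_n) :
  (\dim <<X>> <= n)%N.
Proof. by have := dimvS (subvf <<X>>%VS); rewrite dimvf /dim /= muln1. Qed.

Lemma mulmx_col_sum (R : realType) (n m : nat) (B : 'M[R]_(n, m)) (u : 'cV[R]_m) :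
  B *m u = \sum_(i < m) u i 0 *: (B *m unit_vec R m i.+1).
Proof.
rewrite {1}(_ : u = \sum_(i < m) u i 0 *: unit_vec R m i.+1).
  by rewrite mulmx_sumr; apply: eq_bigr => i _; rewrite scalemxAr.
apply/colP => j; rewrite summxE (bigD1 j) //= !mxE eqxx mulr1.
rewrite big1 ?addr0 // => i ij; rewrite !mxE eqSS.
by rewrite [_ == _ :> nat](negPf _) ?mulr0 // eq_sym.
Qed.

(** * The loop invariant *)

(** The stopping bound, the reachability part and the identification part of
    the argument, for a state at the top of the loop.  The current state is left
    out of the span on which A is known, since its successor is still to come.
    Letting j start at 0 costs nothing: no coordinate has number 0, so
    [unit_vec R m 0] is the zero vector. *)
Record fe_invariant {R : realType} {n m : nat} (A : 'M[R]_n)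
    (B : 'M[R]_(n, m)) (x0 : 'cV[R]_n) (st : fe_state R n m) : Prop := {
  fe_time_dim : (fe_time st).+1 = (\dim <<fe_past st>> + fe_idx st)%N;
  fe_idx_le : (fe_idx st <= m.+1)%N;
  fe_start_mem : x0 \in <<fe_cur st :: fe_past st>>%VS;
  fe_A_mem : forall v, v \in <<fe_past st>>%VS ->
    A *m v \in <<fe_cur st :: fe_past st>>%VS;
  fe_B_mem : forall j, (j < fe_idx st)%N ->
    B *m unit_vec R m j \in <<fe_cur st :: fe_past st>>%VS;
  fe_data_consistent : consistent (fe_data st) (A, B);
  fe_A_determined : forall AB, consistent (fe_data st) AB ->
    forall v, v \in <<fe_past st>>%VS -> AB.1 *m v = A *m v;
  fe_B_determined : forall AB, consistent (fe_data st) AB ->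
    forall j, (j < fe_idx st)%N -> AB.2 *m unit_vec R m j = B *m unit_vec R m j
}.

Lemma fe_init_invariant (R : realType) (n m : nat) (A : 'M[R]_n)
    (B : 'M[R]_(n, m)) (x0 : 'cV[R]_n) :
  fe_invariant A B x0 (fe_init m x0).
Proof.
have span0 (v : 'cV[R]_n) : v \in <<[:: 0%R]>>%VS -> v = 0.
  by rewrite span_seq1 => /vlineP [c ->]; rewrite scaler0.
have unit0 : unit_vec R m 0 = 0 by apply/colP => i; rewrite !mxE.
split=> //=.
- by rewrite span_seq1 dim_vline eqxx.
- exact: head_mem_span.
- by move=> v /span0 ->; rewrite mulmx0 mem0v.
- by case=> // _; rewrite unit0 mulmx0 mem0v.
- by move=> AB _ v /span0 ->; rewrite !mulmx0.
- by move=> AB _ [] // _; rewrite unit0 !mulmx0.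
Qed.

Lemma consistent_setU1 {R : realType} {n m : nat} {D : dataset R n m}
    {xp x : 'cV[R]_n} {u : 'cV[R]_m} {AB : 'M[R]_n * 'M[R]_(n, m)} :
  consistent (D `|` [set (xp, x, u)])%classic AB <->
  consistent D AB /\ xp = AB.1 *m x + AB.2 *m u.
Proof.
split=> [cD | [cD e] xp' x' u' [/cD //|[-> -> ->] //]].
by split=> [xp' x' u' d|]; apply: cD; [left | right].
Qed.

(** A state outside the old span is paired with the input 0 and so reveals its
    image under A.  A state inside it has a known image, so the input e_s reveals
    B e_s as a difference. *)
Lemma fe_step_invariant (R : realType) (n m : nat) (A : 'M[R]_n)
    (B : 'M[R]_(n, m)) (x0 : 'cV[R]_n) (st st' : fe_state R n m) :
  fe_invariant A B x0 st -> fe_step A B st = Some st' ->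
  fe_invariant A B x0 st'.
Proof.
case: st => k x X s D [] /= tE sm x0V AV BV cD detA detB.
rewrite /fe_step /=; have [xX|xX] := ifPn.
  case: ltnP => // sm' [<-].
  have spanE := span_cons_mem xX.
  split; rewrite /fe_apply /= ?spanE /sys_next //.
  - by rewrite tE addnS.
  - exact: span_cons_sub.
  - by move=> v vX; apply: span_cons_sub; apply: AV.
  - move=> j; rewrite ltnS leq_eqVlt => /predU1P [->|js]; last first.
      by apply: span_cons_sub; apply: BV.
    (* B e_s is the new state minus A x, and A x lies in the old span. *)
    rewrite -[X in X \in _](addKr (A *m x)).
    apply: memvD; last exact: head_mem_span.
    by rewrite memvN; apply: span_cons_sub; apply: AV.
  - by apply/consistent_setU1.
  - by move=> AB /consistent_setU1 [/detA].
  - move=> AB /consistent_setU1 [cAB e] j.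
    rewrite ltnS leq_eqVlt => /predU1P [->|js]; last exact: detB.
    by move: e; rewrite (detA _ cAB _ xX) => /addrI.
move=> [<-]; split; rewrite /fe_apply /= /sys_next ?mulmx0 ?addr0 //.
- by rewrite tE (dim_span_cons_notin xX).
- exact: span_cons_sub.
- move=> v /mem_span_cons [c [w [wX ->]]]; rewrite mulmxDr -scalemxAr.
  by apply: memvD; [apply: memvZ; exact: head_mem_span |
                    apply: span_cons_sub; apply: AV].
- by move=> j js; apply: span_cons_sub; apply: BV.
- by apply/consistent_setU1; rewrite /= mulmx0 addr0.
- move=> AB /consistent_setU1 [cAB]; rewrite mulmx0 addr0 => e v.
  move=> /mem_span_cons [c [w [wX ->]]].
  by rewrite !mulmxDr -!scalemxAr -e (detA _ cAB _ wX).
- by move=> AB /consistent_setU1 [/detB].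
Qed.

(** * Termination *)

Lemma fe_time_le {R : realType} {n m : nat} {A : 'M[R]_n} {B : 'M[R]_(n, m)}
    {x0 : 'cV[R]_n} {st : fe_state R n m} :
  fe_invariant A B x0 st -> (fe_time st <= n + m)%N.
Proof.
move=> inv; rewrite -ltnS (fe_time_dim _ _ _ _ inv) -addnS.
by apply: leq_add; [exact: dim_span_col | exact: fe_idx_le inv].
Qed.

(** The invariant bounds the counter, and every pass increments it, so
    n + m - k is a termination measure. *)
Lemma fe_terminates (R : realType) (n m : nat) (A : 'M[R]_n)
    (B : 'M[R]_(n, m)) (x0 : 'cV[R]_n) (st : fe_state R n m) :
  fe_invariant A B x0 st ->
  exists st', [/\ fe_invariant A B x0 st', fe_step A B st' = None &
    fe_exec A B st (fe_time st') (fe_data st')].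
Proof.
have [d] := ubnP (n + m - fe_time st); elim: d st => // d IH st le_d inv.
case step: (fe_step A B st) => [st1|]; last by exists st; split=> //; apply: FEStop.
have inv1 := fe_step_invariant _ _ _ _ _ _ _ _ inv step.
have time1 : fe_time st1 = (fe_time st).+1.
  move: step; rewrite /fe_step; case: ifP => _; last by case=> <-.
  by case: ifP => // _ [<-].
have [|st2 [inv2 stop2 exec2]] := IH st1 _ inv1.
  have := fe_time_le inv1; rewrite time1 => lt_nm.
  by rewrite -ltnS; apply: leq_trans le_d; rewrite ltnS subnS prednK ?subn_gt0.
by exists st2; split=> //; apply: FENext step exec2.
Qed.

(** * Comparison with other experiments *)

(** At the stopping time the visited span is invariant under A and contains x_0
    and the range of B, so it contains every trajectory from x_0. *)
Lemma fe_final_explains_all (R : realType) (n m : nat) (A : 'M[R]_n)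
    (B : 'M[R]_(n, m)) (x0 : 'cV[R]_n) (st : fe_state R n m)
    (AB : 'M[R]_n * 'M[R]_(n, m)) (u : nat -> 'cV[R]_m) (N : nat) :
  fe_invariant A B x0 st -> fe_step A B st = None ->
  consistent (fe_data st) AB -> consistent (trajectory_data A B x0 u N) AB.
Proof.
case: st => k x X s D [] /= _ _ x0V AV BV _ detA detB.
rewrite /fe_step /=; have [xX|//] := ifPn; case: ltnP => // ms _ cAB.
rewrite (span_cons_mem xX) in x0V AV BV.
have trajV j : trajectory A B x0 u j \in <<X>>%VS.
  elim: j => //= j IH; rewrite /sys_next; apply: memvD; first exact: AV.
  rewrite mulmx_col_sum; apply: memv_suml => i _; apply: memvZ; apply: BV.
  exact: leq_ltn_trans (ltn_ord i) ms.
move=> _ _ _ [j _ [-> -> ->]] /=; rewrite /sys_next; congr (_ + _).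
  by rewrite (detA _ cAB _ (trajV j)).
rewrite [LHS]mulmx_col_sum [RHS]mulmx_col_sum; apply: eq_bigr => i _.
by rewrite (detB _ cAB) //; exact: leq_ltn_trans (ltn_ord i) ms.
Qed.

Lemma pseudo_estimator_unique (R : realType) (n m : nat) (D : dataset R n m)
    (A : 'M[R]_n) (B : 'M[R]_(n, m)) :
  uniquely_determines D A B -> pseudo_estimator D = (A, B).
Proof.
rewrite /uniquely_determines => eD; apply: xget_unique.
  by split; rewrite eD // => AB' ->.
by move=> AB []; rewrite eD.
Qed.

Theorem theorem2 (R : realType) (n m : nat) (A : 'M[R]_n) (B : 'M[R]_(n, m))
    (x0 : 'cV[R]_n) :
  exists (N : nat) (D : dataset R n m),
    fast_exploration A B x0 N D /\
    (N <= n + m)%N /\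
    ((exists (N' : nat) (u' : nat -> 'cV[R]_m),
        uniquely_determines (trajectory_data A B x0 u' N') A B) ->
     uniquely_determines D A B /\ (A, B) = pseudo_estimator D).
Proof.
have [st [inv stop exec]] :=
  fe_terminates _ _ _ _ _ _ _ (fe_init_invariant _ _ _ A B x0).
exists (fe_time st), (fe_data st); split=> //; split; first exact: fe_time_le inv.
move=> [N' [u' eD']].
have eD : uniquely_determines (fe_data st) A B.
  apply/seteqP; split=> [AB cAB|_ ->]; last exact: fe_data_consistent inv.
  by rewrite -eD'; apply: fe_final_explains_all inv stop cAB.
by split=> //; rewrite (pseudo_estimator_unique _ _ _ _ _ _ eD).
Qed.
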